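(* Let $X$ be a Baire space which is also Hausdorff, and let $\sigma : X \rightarrow X$ be a homeomorphism, inducing the automorphism $\widetilde{\sigma}$ of $C(X)$ given by $\widetilde{\sigma}(f)=f\circ\sigma^{-1}$. Suppose $A$ is a subalgebra of $C(X)$ that is invariant under $\widetilde{\sigma}$ and its inverse, separates the points of $X$, and is such that for every non-empty open set $U \subseteq X$ there is a non-zero $f \in A$ that vanishes on the complement of $U$. Then the following three statements are equivalent: (1) $A$ is a maximal abelian subalgebra of $A \rtimes_{\widetilde{\sigma}} \mathbb{Z}$; (2) $\mathrm{Per}^{\infty}(X)$, defined as the set of non-periodic points $\{x\in X : \sigma^n(x)\neq x \text{ for all } n\in\mathbb{Z}\setminus\{0\}\}$, is dense in $X$; (3) every non-zero two-sided ideal $I \subseteq A \rtimes_{\widetilde{\sigma}} \mathbb{Z}$ is such that $I \cap A \neq \{0\}$.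
   Context: $C(X)$ is the algebra of all continuous complex-valued functions on $X$. Algebras are not assumed to be unital. For an associative commutative complex algebra $A$ and an algebra automorphism $\Psi : A \to A$ (here $\Psi$ is the restriction of $\widetilde{\sigma}$ to $A$), the crossed product $A \rtimes_{\Psi} \mathbb{Z}$ is the associative complex algebra of all finite formal sums $\sum_{n\in\mathbb{Z}} f_n\delta^n$ with $f_n\in A$, with coefficientwise addition and scalar multiplication, and with multiplication determined by $(f_n\delta^n)*(g_m\delta^m)=f_n\cdot\Psi^n(g_m)\,\delta^{n+m}$. The algebra $A$ is identified with the abelian subalgebra $\{f_0\delta^0 : f_0\in A\}$. *)

(* Defs.v *)
From HB Require Import structures.
From mathcomp Require Import all_boot all_order all_algebra.
From mathcomp Require Import complex.
From mathcomp Require Import all_classical all_reals.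
From mathcomp Require Import topology.

Set Implicit Arguments.
Unset Strict Implicit.
Unset Printing Implicit Defensive.

Import Order.TTheory GRing.Theory Num.Theory.

Local Open Scope classical_set_scope.
Local Open Scope ring_scope.

(* Algebras are associative, possibly without unit.  An algebra over K is
   given by a subspace E of an ambient K-module V together with a product on
   V for which E is closed. *)
Section Algebras.
Context {K : pzRingType} {V : lmodType K} (E : set V) (mul : V -> V -> V).

Definition subalgebra (B : set V) : Prop :=
  [/\ B `<=` E,
      B 0,
      forall a b, B a -> B b -> B (a + b),
      forall (c : K) a, B a -> B (c *: a) &
      forall a b, B a -> B b -> B (mul a b)].

Definition abelian_subalgebra (B : set V) : Prop :=
  subalgebra B /\ forall a b, B a -> B b -> mul a b = mul b a.

Definition maximal_abelian_subalgebra (B : set V) : Prop :=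
  abelian_subalgebra B /\
  forall B', abelian_subalgebra B' -> B `<=` B' -> B' = B.

Definition two_sided_ideal (I : set V) : Prop :=
  [/\ I `<=` E,
      I 0,
      forall a b, I a -> I b -> I (a + b),
      forall (c : K) a, I a -> I (c *: a) &
      forall a b, E a -> I b -> I (mul a b) /\ I (mul b a)].

End Algebras.

(* The n-th power, n in Z, of a bijection f whose inverse is g. *)
Definition iterz (T : Type) (f g : T -> T) (n : int) : T -> T :=
  match n with
  | Posz k => iter k f
  | Negz k => iter k.+1 g
  end.

Section Topology.
Context {X : topologicalType}.

Definition baire_space : Prop :=
  forall F : nat -> set X,
    (forall i, open (F i) /\ dense (F i)) -> dense (\bigcap_i F i).

Definition homeomorphism_with_inverse (sigma tau : X -> X) : Prop :=
  [/\ cancel sigma tau, cancel tau sigma, continuous sigma & continuous tau].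

Definition aperiodic_points (sigma tau : X -> X) : set X :=
  [set x | forall n : int, n != 0 -> iterz sigma tau n x <> x].

End Topology.

Arguments baire_space X : clear implicits.

Section ContinuousFunctions.
Context {R : realType} {X : topologicalType}.

(* R[i]^o is the complex field, with the topology of its modulus, seen as a
   module over itself. *)
Definition continuous_functions : set (X -> R[i]^o) := [set f | continuous f].

Definition separates_points (A : set (X -> R[i]^o)) : Prop :=
  forall x y : X, x <> y -> exists2 f, A f & f x <> f y.

(* The automorphism f |-> f o sigma^-1 is precomp tau, for tau the inverse of
   sigma, and its inverse is precomp sigma. *)
Definition precomp (s : X -> X) (f : X -> R[i]^o) : X -> R[i]^o := f \o s.

End ContinuousFunctions.

Arguments continuous_functions R X : clear implicits.

(* Crossed product by Z of A, a set of elements of U on which the mutually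
   inverse maps psi and psi' act; the formal sum \sum_n f_n delta^n is encoded
   by its coefficient family n |-> f_n. *)
Section CrossedProduct.
Context {U : pzRingType} (psi psi' : U -> U).

Definition crossed_product (A : set U) : set (int -> U) :=
  [set a | (forall n, A (a n)) /\ finite_set [set n | a n <> 0]].

Definition monomial (f : U) (n : int) : int -> U :=
  fun m => if m == n then f else 0.

(* For a in a crossed product the terms vanish for all but finitely many k. *)
Definition crossed_mul (a b : int -> U) : int -> U :=
  fun n => \sum_(k \in [set: int]) a k * iterz psi psi' k (b (n - k)).

Definition coefficient_copy (A : set U) : set (int -> U) :=
  [set monomial f 0 | f in A].

End CrossedProduct.

Section CrossedProductFacts.
Context {U : pzRingType} (psi psi' : U -> U).

Lemma crossed_mul_monomial (f g : U) (n m : int) :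
  psi 0 = 0 -> psi' 0 = 0 ->
  crossed_mul psi psi' (monomial f n) (monomial g m)
  = monomial (f * iterz psi psi' n g) (n + m).
Proof.
move=> psi0 psi'0; have it0 k : iterz psi psi' k 0 = 0.
  by case: k => k /=; [|rewrite -iterS]; elim: k => //= k ->.
apply/funext => p; rewrite /crossed_mul /monomial.
rewrite -(fsbig_widen [set n] setT) //=; last first.
  by move=> k [_ /= /eqP/negPf ->]; rewrite mul0r.
rewrite fsbig_set1 eqxx.
by rewrite subr_eq addrC; case: eqP => // _; rewrite it0 mulr0.
Qed.

Lemma crossed_mulDl (a a' b : int -> U) :
  finite_set [set n | a n <> 0] -> finite_set [set n | a' n <> 0] ->
  crossed_mul psi psi' (a + a') b
  = crossed_mul psi psi' a b + crossed_mul psi psi' a' b.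
Proof.
move=> fa fa'; apply/funext => n.
rewrite -[RHS]/(crossed_mul psi psi' a b n + crossed_mul psi psi' a' b n).
rewrite /crossed_mul /=.
pose S := [set n | a n <> 0] `|` [set n | a' n <> 0].
have fS : finite_set S by rewrite finite_setU.
have aS k : ~ S k -> a k = 0 /\ a' k = 0.
  by rewrite /S/= => /not_orP[/contrapT -> /contrapT ->].
rewrite -!(fsbig_widen S setT)//=.
- by rewrite -fsbig_split//=; apply: eq_fsbigr => k _; rewrite mulrDl.
all: move=> k [_ /= /aS[ak a'k]]; rewrite ?addrfctE.
all: by rewrite ?ak ?a'k ?addr0 mul0r.
Qed.

Lemma crossed_mulDr (a b b' : int -> U) :
  {morph psi : x y / x + y} -> {morph psi' : x y / x + y} ->
  finite_set [set n | a n <> 0] ->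
  crossed_mul psi psi' a (b + b')
  = crossed_mul psi psi' a b + crossed_mul psi psi' a b'.
Proof.
move=> psiD psi'D fa; apply/funext => n.
rewrite -[RHS]/(crossed_mul psi psi' a b n + crossed_mul psi psi' a b' n).
rewrite /crossed_mul.
have itD k : {morph iterz psi psi' k : x y / x + y}.
  move=> x y; case: k => k /=.
    by elim: k => //= k ->.
  by rewrite -!iterS; elim: (k.+1) => //= j ->.
pose S := [set n | a n <> 0].
have aS k : ~ S k -> a k = 0 by move=> /contrapT.
rewrite -!(fsbig_widen S setT)//=;
  try by move=> k [_ /= /aS ->]; rewrite mul0r.
by rewrite -fsbig_split//=; apply: eq_fsbigr => k _; rewrite -mulrDr -itD.
Qed.

End CrossedProductFacts.

(* Main.v *)
Require Import Defs.
From mathcomp Require Import all_boot all_order all_algebra.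
From mathcomp Require Import complex.
From mathcomp Require Import all_classical all_reals.
From mathcomp Require Import topology.

Import Order.TTheory GRing.Theory Num.Theory.

Local Open Scope classical_set_scope.
Local Open Scope ring_scope.

Set Implicit Arguments.
Unset Strict Implicit.

(** Write phi n for the n-th iterate of tau = sigma^-1, so that the coefficients
    of a product in the crossed product are

      (a * b)_n (x) = \sum_k a_k(x) b_(n-k)(phi k x).

    Both equivalences rest on comparing the support of the coefficient a_k with
    the fixed-point set of phi k.

    Commutant.  Since A separates points, comparing the coefficients of f * a
    and a * f for f in A shows that a commutes with A only if phi k x = x
    whenever a_k(x) is non-zero ([commutant_isotropic]).  If the aperiodic points
    are dense, continuity forces a_k = 0 for every non-zero k, so A is its own
    commutant and hence maximal abelian ([dense_maximal_abelian]).  Conversely,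
    on elements with this support property the formula above becomes
    \sum_k a_k(x) b_(n-k)(x), which is symmetric, so they form an abelian
    subalgebra containing A ([isotropic_subalgebra]).  If the aperiodic points
    are not dense, then, the fixed-point sets being closed, the Baire property
    yields n > 0 and a non-empty open set U fixed pointwise by phi n
    ([open_periodic_points]); a non-zero f in A vanishing off U gives an element
    f delta^n of that subalgebra lying outside A, so A is not maximal abelian.

    Ideals.  Suppose the aperiodic points are dense and I is a non-zero ideal.
    A right multiplication by some g delta^-m gives b in I with b_0 non-zero, and
    b_0 is then non-zero at an aperiodic point x.  For f in A vanishing off a
    neighbourhood of x that is disjoint from its images under the finitely many
    relevant phi k, the product f * b * f keeps only its degree zero term
    ([ideal_detects]).  Conversely, if phi n fixes a non-empty open set pointwise,
    then multiplication by delta^n (that is, shifting degrees by n) commutes with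
    left and right multiplications on the elements c whose coefficients vanish
    off the fixed points of phi n.  The elements c - c delta^n therefore form an
    ideal, which is non-zero, and which meets A trivially because a finitely
    supported family cannot be constant along an arithmetic progression
    ([shift_ideal_meets]). *)

(** * Integer iterates of a bijection *)

Section IntegerIterates.
Context {T : Type} {f g : T -> T} (fK : cancel f g) (gK : cancel g f).

Lemma iterzN (n : int) : iterz g f (- n) = iterz f g n.
Proof. by case: n => [[|k]|k]. Qed.

Lemma iterz1D (n : int) (x : T) : iterz f g (1 + n) x = f (iterz f g n x).
Proof.
by case: n => [k|[|k]] /=; rewrite ?gK // subn1 /= ?gK.
Qed.

Lemma iterzB1 (n : int) (x : T) : iterz f g (n - 1) x = g (iterz f g n x).
Proof. by rewrite -[n in RHS](subrK 1) [_ - 1 + 1]addrC iterz1D fK. Qed.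

Lemma iterzD (m n : int) (x : T) :
  iterz f g (m + n) x = iterz f g m (iterz f g n x).
Proof.
elim/int_rec: m => [|m IH|m IH]; first by rewrite add0r.
  by rewrite -[m.+1]addn1 PoszD [_ + 1]addrC -addrA !iterz1D IH.
by rewrite -[m.+1]addn1 PoszD opprD addrAC !iterzB1 IH.
Qed.

Lemma iterz_fixed_opp (n : int) (x : T) :
  iterz f g n x = x -> iterz f g (- n) x = x.
Proof. by move=> nx; rewrite -{1}nx -iterzD addNr. Qed.

Lemma iterz_fixed_iterz (m n : int) (x : T) :
  iterz f g n x = x -> iterz f g n (iterz f g m x) = iterz f g m x.
Proof. by move=> nx; rewrite -iterzD addrC iterzD nx. Qed.

End IntegerIterates.

Lemma iterz_precomp (R : realType) (X : topologicalType) (s t : X -> X)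
    (k : int) (h : X -> R[i]^o) :
  iterz (precomp s) (precomp t) k h = h \o iterz s t k.
Proof.
have iterP (u : X -> X) j : iter j (precomp u) h = h \o iter j u.
  by elim: j => //= j ->; apply/funext => x; rewrite /precomp /= -iterSr.
by case: k => k; rewrite /iterz iterP.
Qed.

Lemma iterz_invariant (T : Type) (f g : T -> T) (A : set T) (k : int) (x : T) :
  (forall y, A y -> A (f y) /\ A (g y)) -> A x -> A (iterz f g k x).
Proof.
move=> Afg Ax; have iterA h j : (forall y, A y -> A (h y)) -> A (iter j h x).
  by move=> Ah; elim: j => //= j /Ah.
by case: k => k; apply: iterA => y /Afg[].
Qed.

(** * Evaluating crossed products of functions at a point *)

Lemma open_neq0 {R : realType} {X : topologicalType} (f : X -> R[i]^o) :
  continuous f -> open [set x | f x <> 0].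
Proof.
move=> fcont; rewrite openE => x /eqP fx0.
apply: (fcont x [set y | y <> 0]); exists `|f x|; first by rewrite /= normr_gt0.
by move=> y /= + y0; rewrite y0 subr0 ltxx.
Qed.

Lemma neq0_at {X : Type} {V : nmodType} (f : X -> V) :
  f <> 0 -> exists x, f x <> 0.
Proof.
apply: contra_notP => /forallNP f0; apply/funext => x.
by apply: contrapT; exact: f0.
Qed.

Section Coefficients.
Context {U : pzRingType} {psi psi' : U -> U} {A : set U}.

Lemma crossed_product_monomial (f : U) (n : int) :
  A 0 -> A f -> crossed_product A (monomial f n).
Proof.
move=> A0 Af; split=> [m|]; first by rewrite /monomial; case: ifP.
apply: (sub_finite_set (B := [set n])) => // m /=.
by rewrite /monomial; case: eqP.
Qed.

(** The coefficient [(a * b) n] only involves the products of [a k] and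
    [b (n - k)], so the support of [a * b] lies in the sum of the supports. *)
Lemma crossed_product_mul (a b : int -> U) :
  A 0 -> (forall f g, A f -> A g -> A (f + g)) ->
  (forall f g, A f -> A g -> A (f * g)) ->
  (forall f, A f -> A (psi f) /\ A (psi' f)) -> psi 0 = 0 -> psi' 0 = 0 ->
  crossed_product A a -> crossed_product A b ->
  crossed_product A (crossed_mul psi psi' a b).
Proof.
move=> A0 AD AM Apsi psi0 psi'0 [Aa fa] [Ab fb].
have it0 k : iterz psi psi' k 0 = 0.
  by apply: (@iterz_invariant _ _ _ [set 0]) => // y ->; rewrite psi0 psi'0.
split=> [n|].
  have Aterm k : A (a k * iterz psi psi' k (b (n - k))).
    by apply: AM => //; exact: iterz_invariant.
  rewrite /crossed_mul -(fsbig_widen [set k | a k <> 0] setT) //=.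
    rewrite fsbig_finite //; exact: big_ind.
  by move=> k [_ /= /contrapT ->]; rewrite mul0r.
apply: sub_finite_set (finite_image2 (fun k l : int => k + l) fa fb) => n /=.
apply: contra_notP => nab; apply: fsbig1 => k _.
have [->|/eqP ak] := eqVneq (a k) 0; first by rewrite mul0r.
have [->|/eqP bk] := eqVneq (b (n - k)) 0; first by rewrite it0 mulr0.
by exfalso; apply: nab; exists k => //; exists (n - k); rewrite // addrC subrK.
Qed.

End Coefficients.

(** A non-zero value taken along a whole arithmetic progression would make the
    support infinite. *)
Lemma finite_support_progression (U : nmodType) (c : int -> U)
    (a m : int) (v : U) :
  finite_set [set k | c k <> 0] -> m != 0 ->
  (forall j : nat, c (a + m *+ j) = v) -> v = 0.
Proof.
move=> fc m0 cv; apply: contrapT => v0; apply: infinite_nat.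
have : finite_set ((fun j : nat => a + m *+ j) @^-1` [set k | c k <> 0]).
  apply: finite_preimage fc => i j _ _ /addrI; exact: mulrIn.
by apply: sub_finite_set => j _ /=; rewrite cv.
Qed.

Section Evaluation.
Context {R : realType} {X : topologicalType} {sigma tau : X -> X}.

Local Notation mul := (crossed_mul (precomp tau) (precomp sigma)).
Local Notation phi := (iterz tau sigma).

Lemma crossed_mul_at (a b : int -> X -> R[i]^o) (n : int) (x : X) :
  finite_set [set k | a k <> 0] ->
  mul a b n x = \sum_(k \in [set: int]) a k x * b (n - k) (phi k x).
Proof.
move=> fa; rewrite /crossed_mul -(fsbig_widen [set k | a k <> 0] setT) //=.
  rewrite fsbig_finite // fct_sumE -fsbig_finite //=.
  rewrite -(fsbig_widen [set k | a k <> 0] setT) //=.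
    by apply: eq_fsbigr => k _; rewrite iterz_precomp.
  by move=> k [_ /= /contrapT ->]; rewrite mul0r.
by move=> k [_ /= /contrapT ->]; rewrite mul0r.
Qed.

Lemma crossed_mul_monomial_l (f : X -> R[i]^o) (m : int)
    (b : int -> X -> R[i]^o) (n : int) (x : X) :
  mul (monomial f m) b n x = f x * b (n - m) (phi m x).
Proof.
rewrite /crossed_mul -(fsbig_widen [set m] setT) //=.
  by rewrite fsbig_set1 /monomial eqxx iterz_precomp.
by move=> k [_ /= /eqP/negPf km]; rewrite /monomial km mul0r.
Qed.

Lemma crossed_mul_monomial_r (a : int -> X -> R[i]^o) (g : X -> R[i]^o)
    (m n : int) (x : X) :
  mul a (monomial g m) n x = a (n - m) x * g (phi (n - m) x).
Proof.
rewrite /crossed_mul -(fsbig_widen [set n - m] setT) //=.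
  by rewrite fsbig_set1 /monomial subKr eqxx iterz_precomp.
move=> k [_ /= /eqP km]; rewrite /monomial subr_eq addrC -subr_eq eq_sym.
by rewrite (negPf km) iterz_precomp; apply/funext => y; exact: mulr0.
Qed.

End Evaluation.

(** * Points moved by a homeomorphism *)

Lemma continuous_iterz (X : topologicalType) (f g : X -> X) (n : int) :
  continuous f -> continuous g -> continuous (iterz f g n).
Proof.
move=> fc gc; have iterc (h : X -> X) j : continuous h -> continuous (iter j h).
  move=> hc; elim: j => [|j IH] x /=; first exact: cvg_id.
  by apply: continuous_comp; [exact: IH|exact: hc].
by case: n => n; apply: iterc.
Qed.

Lemma moved_nbhs (X : topologicalType) (f : X -> X) (x : X) :
  hausdorff_space X -> continuous f -> f x <> x ->
  exists2 V, nbhs x V & forall y, V y -> ~ V (f y).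
Proof.
rewrite open_hausdorff => haus fc /eqP; rewrite eq_sym => /haus.
move=> [[P Q]] /= [/set_mem Px /set_mem Qfx] [oP oQ /eqP PQ0].
exists (P `&` f @^-1` Q).
  by apply: filterI; [|apply: fc]; apply: open_nbhs_nbhs.
by move=> y [Py Qfy] [Pfy _]; suff: (P `&` Q) (f y) by rewrite PQ0.
Qed.

Lemma open_moved (X : topologicalType) (f : X -> X) :
  hausdorff_space X -> continuous f -> open [set x | f x <> x].
Proof.
move=> haus fc; rewrite openE => x /(moved_nbhs haus fc)[V Vx Vf].
by apply: filterS Vx => y Vy fy; apply: (Vf y) => //; rewrite fy.
Qed.

(** Intersecting the neighbourhoods given by [moved_nbhs] for the finitely many
    indices; this is what kills all but one coefficient in [ideal_detects]. *)
Lemma moved_nbhs_finite (X : topologicalType) (f : int -> X -> X) (S : set int)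
    (x : X) :
  hausdorff_space X -> (forall k, continuous (f k)) -> finite_set S ->
  (forall k, S k -> f k x <> x) ->
  exists2 V, nbhs x V & forall k y, S k -> V y -> ~ V (f k y).
Proof.
move=> haus fc finS Sx.
have /choice[W WP] k : exists W, nbhs x W /\
    (S k -> forall y, W y -> ~ W (f k y)).
  have [Sk|nSk] := pselect (S k).
    by have [W] := moved_nbhs haus (fc k) (Sx k Sk); exists W.
  by exists setT; split=> //; exact: filterT.
exists (\bigcap_(k in S) W k).
  rewrite -(fset_setK finS); apply: filter_bigI => k _; exact: (WP k).1.
by move=> k y Sk Vy Vfy; apply: ((WP k).2 Sk y); [exact: Vy|exact: Vfy].
Qed.

Section Dynamics.
Context {X : topologicalType} {sigma tau : X -> X}.
Hypothesis sigma_homeo : homeomorphism_with_inverse sigma tau.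

Local Notation phi := (iterz tau sigma).

Let sigmaK : cancel sigma tau. Proof. by case: sigma_homeo. Qed.
Let tauK : cancel tau sigma. Proof. by case: sigma_homeo. Qed.

(** Products involve the iterates [phi] of the inverse; periodicity is the same
    for a map and its inverse. *)
Lemma aperiodicP (x : X) :
  aperiodic_points sigma tau x <-> forall n, n != 0 -> phi n x <> x.
Proof.
by split=> xap n n0; [rewrite -iterzN|rewrite -[n]opprK iterzN];
  [apply: xap; rewrite oppr_eq0|apply: xap; rewrite oppr_eq0].
Qed.

Lemma aperiodic_posP (x : X) :
  (forall n : nat, phi n.+1 x <> x) -> aperiodic_points sigma tau x.
Proof.
move=> xap; apply/aperiodicP => -[[|n]|n]; first by rewrite eqxx.
  by move=> _; exact: xap.
move=> _; rewrite NegzE => /(iterz_fixed_opp tauK sigmaK).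
by rewrite opprK; exact: xap.
Qed.

(** The aperiodic points are the intersection over n > 0 of the sets of points
    moved by [phi n], which are open because X is Hausdorff.  If none of the
    fixed-point sets contained a non-empty open set, these sets would all be
    dense, and so would their intersection by the Baire property. *)
Lemma open_periodic_points :
  baire_space X -> hausdorff_space X -> ~ dense (aperiodic_points sigma tau) ->
  exists n : nat, exists U, [/\ open U, U !=set0 &
    forall x, U x -> phi n.+1 x = x].
Proof.
move=> baire haus; apply: contra_notP => noper.
have [_ _ sigmac tauc] := sigma_homeo.
have phic n : continuous (phi n) by exact: continuous_iterz.
have : dense (\bigcap_i [set x | phi i.+1 x <> x]).
  apply: baire => n; split; first exact: open_moved.
  move=> U U0 oU; apply: contrapT => UF; apply: noper; exists n; exists U.
  split=> // x Ux; apply: contrapT => xn; apply: UF; by exists x.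
move=> dF U U0 /dF-/(_ U0)[x [Ux Fx]]; exists x; split=> //.
by apply: aperiodic_posP => n; exact: Fx.
Qed.

End Dynamics.

(** * The commutant of the coefficient algebra *)

Section Criteria.
Context {R : realType} {X : topologicalType} {sigma tau : X -> X}.
Context {A : set (X -> R[i]^o)}.
Hypothesis sigma_homeo : homeomorphism_with_inverse sigma tau.
Hypothesis A_subalgebra : subalgebra (continuous_functions R X) *%R A.
Hypothesis A_invariant :
  forall f, A f -> A (precomp tau f) /\ A (precomp sigma f).

Local Notation AxZ := (crossed_product A).
Local Notation mul := (crossed_mul (precomp tau) (precomp sigma)).
Local Notation A0 := (coefficient_copy A).
Local Notation phi := (iterz tau sigma).

Let sigmaK : cancel sigma tau. Proof. by case: sigma_homeo. Qed.
Let tauK : cancel tau sigma. Proof. by case: sigma_homeo. Qed.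
Let phic n : continuous (phi n).
Proof. by case: sigma_homeo => *; exact: continuous_iterz. Qed.
Let A_cont f : A f -> continuous f.
Proof. by case: A_subalgebra => + *; exact. Qed.
Let A_0 : A 0. Proof. by case: A_subalgebra. Qed.
Let A_D f g : A f -> A g -> A (f + g).
Proof. by case: A_subalgebra => *; auto. Qed.
Let A_Z (c : R[i]) f : A f -> A (c *: f).
Proof. by case: A_subalgebra => *; auto. Qed.
Let A_M f g : A f -> A g -> A (f * g).
Proof. by case: A_subalgebra => *; auto. Qed.

Lemma crossed_product0 : AxZ 0.
Proof.
by split=> //; apply: (sub_finite_set (B := set0)) => // n /=; apply.
Qed.

Lemma crossed_productD a b : AxZ a -> AxZ b -> AxZ (a + b).
Proof.
move=> [Aa fa] [Ab fb]; split=> [n|]; first exact: A_D.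
have fab : finite_set ([set n | a n <> 0] `|` [set n | b n <> 0]).
  by rewrite finite_setU.
apply: sub_finite_set fab => n /=.
apply: contra_notP => /not_orP[/contrapT an /contrapT bn].
by rewrite addrfctE an bn addr0.
Qed.

Lemma crossed_productZ (c : R[i]) a : AxZ a -> AxZ (c *: a).
Proof.
move=> [Aa fa]; split=> [n|]; first exact: A_Z.
apply: sub_finite_set fa => n /=; apply: contra_not => an.
by rewrite -[LHS]/(c *: a n) an scaler0.
Qed.

Lemma crossed_productM a b : AxZ a -> AxZ b -> AxZ (mul a b).
Proof. exact: crossed_product_mul. Qed.

Lemma coefficient_copy_subalgebra : abelian_subalgebra AxZ mul A0.
Proof.
have mulA0 f g : mul (monomial f 0) (monomial g 0) = monomial (f * g) 0.
  by rewrite crossed_mul_monomial.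
split; last by move=> _ _ [f _ <-] [g _ <-]; rewrite !mulA0 mulrC.
split.
- by move=> _ [f Af <-]; exact: crossed_product_monomial.
- by exists 0 => //; apply/funext => n; rewrite /monomial; case: ifP.
- move=> _ _ [f Af <-] [g Ag <-]; exists (f + g); first exact: A_D.
  apply/funext => n; rewrite -[RHS]/(monomial f 0 n + monomial g 0 n) /monomial.
  by case: ifP; rewrite ?addr0.
- move=> c _ [f Af <-]; exists (c *: f); first exact: A_Z.
  apply/funext => n; rewrite -[RHS]/(c *: monomial f 0 n) /monomial.
  by case: ifP; rewrite ?scaler0.
- move=> _ _ [f Af <-] [g Ag <-]; rewrite mulA0.
  by exists (f * g) => //; exact: A_M.
Qed.

(** The support condition describing the commutant of A: each [a k] lives on the
    points whose isotropy group under the action of the integers contains k. *)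
Definition isotropic (a : int -> X -> R[i]^o) : Prop :=
  forall k x, a k x <> 0 -> phi k x = x.

(** In degree k, commutation of a with f reads
    f(x) a_k(x) = a_k(x) f(phi k x); where a_k(x) is non-zero, no f in A
    separates x from phi k x. *)
Lemma commutant_isotropic a :
  separates_points A ->
  (forall f, A f -> mul (monomial f 0) a = mul a (monomial f 0)) ->
  isotropic a.
Proof.
move=> sepA acomm k x akx; apply: contrapT => /sepA[f Af fx]; apply: fx.
have /(congr1 (fun c => c k x)) := acomm f Af.
rewrite crossed_mul_monomial_l crossed_mul_monomial_r !subr0 mulrC.
by move/eqP: akx => akx /(mulfI akx) ->.
Qed.

Lemma isotropic_crossed_mul (a b : int -> X -> R[i]^o) (n : int) (x : X) :
  finite_set [set k | a k <> 0] -> isotropic a ->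
  mul a b n x = \sum_(k \in [set: int]) a k x * b (n - k) x.
Proof.
move=> fa isoa; rewrite crossed_mul_at//; apply: eq_fsbigr => k _.
have [->|/eqP/isoa -> //] := eqVneq (a k x) 0.
by rewrite !mul0r.
Qed.

(** The translations disappear from the product, leaving the convolution of two
    families of scalars, which is symmetric under k |-> n - k. *)
Lemma isotropic_commute a b :
  finite_set [set k | a k <> 0] -> finite_set [set k | b k <> 0] ->
  isotropic a -> isotropic b -> mul a b = mul b a.
Proof.
move=> fa fb isoa isob; apply/funext => n; apply/funext => x.
rewrite !isotropic_crossed_mul// (reindex_fsbigT (fun k => n - k)); last first.
  by exists (fun k => n - k) => k; exact: subKr.
by apply: eq_fsbigr => k _; rewrite subKr mulrC.
Qed.

Lemma crossed_mul_neq0 (a b : int -> X -> R[i]^o) (n : int) (x : X) :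
  finite_set [set k | a k <> 0] ->
  mul a b n x <> 0 -> exists k, a k x <> 0 /\ b (n - k) (phi k x) <> 0.
Proof.
move=> fa; rewrite crossed_mul_at//; apply: contra_notP => /forallNP ab0.
apply: fsbig1 => k _; have /not_andP[/contrapT ->|/contrapT ->] := ab0 k.
  by rewrite mul0r.
by rewrite mulr0.
Qed.

Lemma isotropic_subalgebra :
  abelian_subalgebra AxZ mul [set a | AxZ a /\ isotropic a].
Proof.
split; last first.
  by move=> a b [[_ fa] isoa] [[_ fb] isob]; exact: isotropic_commute.
split.
- by move=> a [].
- by split; [exact: crossed_product0|].
- move=> a b [Aa isoa] [Ab isob]; split; first exact: crossed_productD.
  move=> k x; rewrite -[(a + b) k x]/(a k x + b k x).
  have [->|/eqP/isoa//] := eqVneq (a k x) 0; rewrite add0r; exact: isob.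
- move=> c a [Aa isoa]; split; first exact: crossed_productZ.
  move=> k x; rewrite -[(c *: a) k x]/(c * a k x).
  have [->|/eqP/isoa//] := eqVneq (a k x) 0; by rewrite mulr0.
- move=> a b [Aa isoa] [Ab isob]; split; first exact: crossed_productM.
  move=> n x /(crossed_mul_neq0 Aa.2)[k [/isoa kx]]; rewrite kx => /isob nkx.
  by rewrite -[n](subrK k) (iterzD tauK sigmaK) kx.
Qed.

Lemma isotropic_coefficient_copy : A0 `<=` isotropic.
Proof.
by move=> _ [f _ <-] k x; rewrite /monomial; case: eqP => // ->.
Qed.

(** For non-zero n the set where [a n] is non-zero is open and contains no
    aperiodic point. *)
Lemma dense_isotropic a :
  dense (aperiodic_points sigma tau) -> AxZ a -> isotropic a -> A0 a.
Proof.
move=> dap [Aa _] isoa; exists (a 0) => //; apply/funext => n.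
rewrite /monomial; case: eqP => [-> //|/eqP n0]; apply/esym.
apply: contrapT => /neq0_at an0.
have [x [/= anx /aperiodicP]] := dap _ an0 (open_neq0 (A_cont (Aa n))).
by move=> /(_ n n0); apply; exact: isoa.
Qed.

Lemma dense_maximal_abelian :
  separates_points A -> dense (aperiodic_points sigma tau) ->
  maximal_abelian_subalgebra AxZ mul A0.
Proof.
move=> sepA dap; split; first exact: coefficient_copy_subalgebra.
move=> B [[BAxZ _ _ _ _] Bcomm] A0B; apply/seteqP; split=> // a Ba.
apply: dense_isotropic => //; first exact: BAxZ.
apply: commutant_isotropic => // f Af.
by apply: Bcomm => //; apply: A0B; exists f.
Qed.

Hypothesis A_local : forall U : set X, open U -> U !=set0 ->
  exists f, [/\ A f, f <> 0 & forall x, ~ U x -> f x = 0].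

(** An f in A vanishing off an open set fixed pointwise by [phi n] gives an
    isotropic element [monomial f n] outside A. *)
Lemma maximal_abelian_dense :
  baire_space X -> hausdorff_space X ->
  maximal_abelian_subalgebra AxZ mul A0 ->
  dense (aperiodic_points sigma tau).
Proof.
move=> baire haus [_ A0max]; apply: contrapT.
move=> /(open_periodic_points sigma_homeo baire haus)[n [U [oU U0 Uper]]].
have [f [Af f0 fU]] := A_local oU U0.
have isoA0 : [set a | AxZ a /\ isotropic a] = A0.
  apply: A0max; first exact: isotropic_subalgebra.
  move=> a A0a; split; last exact: isotropic_coefficient_copy.
  by case: A0a => g Ag <-; exact: crossed_product_monomial.
have : A0 (monomial f n.+1).
  rewrite -isoA0; split; first exact: crossed_product_monomial.
  move=> k x; rewrite /monomial; case: eqP => // -> fx.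
  by apply: Uper; apply: contrapT => /fU.
move=> [g _ /(congr1 (fun c => c n.+1%:Z))]; rewrite /monomial eqxx => fg.
by apply: f0; rewrite -fg.
Qed.

(** * Ideals meeting the coefficient algebra *)

(** Take V a neighbourhood of x, inside the set where b_0 is non-zero, which no
    [phi k] with b_k non-zero and k non-zero maps to a set meeting V, and f in A
    vanishing off V.  The degree k coefficient f(y) b_k(y) f(phi k y) of f * b * f
    vanishes for k non-zero, because y and phi k y are not both in V. *)
Lemma ideal_detects I b x :
  hausdorff_space X -> two_sided_ideal AxZ mul I -> I b ->
  aperiodic_points sigma tau x -> b 0 x <> 0 ->
  exists f, [/\ A f, f <> 0 & I (monomial f 0)].
Proof.
move=> haus [IAxZ _ _ _ IM] Ib /aperiodicP xap b0x.
have [Ab fb] := IAxZ b Ib.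
have fS : finite_set ([set k | b k <> 0] `\ 0) by exact: finite_setD.
have [|V Vx Vb] := @moved_nbhs_finite X phi _ x haus phic fS.
  by move=> k [_ /eqP k0]; exact: xap.
have ob0 := open_neq0 (A_cont (Ab 0)).
have [f [Af f0 fV]] : exists f, [/\ A f, f <> 0 &
    forall y, ~ (V° `&` [set z | b 0 z <> 0]) y -> f y = 0].
  apply: A_local; first by apply: openI => //; exact: open_interior.
  by exists x; split.
have AxZf : AxZ (monomial f 0) by exact: crossed_product_monomial.
have Ifbf := (IM _ _ AxZf (IM _ _ AxZf Ib).1).2.
have E n y : mul (mul (monomial f 0) b) (monomial f 0) n y
           = f y * b n y * f (phi n y).
  by rewrite crossed_mul_monomial_r crossed_mul_monomial_l !subr0.
exists (f * b 0 * f); split; first by do 2! apply: A_M => //.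
  have [y fy] := neq0_at f0.
  have by0 : b 0 y <> 0.
    by apply: contrapT => by0; apply: fy; apply: fV => -[].
  move=> /(congr1 (fun g => g y)).
  rewrite -[LHS]/(f y * b 0 y * f y) => /eqP.
  by rewrite !mulf_eq0; case/orP => [/orP[]|] /eqP.
suff <- : mul (mul (monomial f 0) b) (monomial f 0) = monomial (f * b 0 * f) 0.
  by [].
apply/funext => n; apply/funext => y; rewrite E /monomial.
case: eqP => [-> //|n0]; rewrite -[RHS]/(0 : R[i]).
have [->|/eqP bny] := eqVneq (b n y) 0; first by rewrite mulr0 mul0r.
have [->|/eqP fy] := eqVneq (f y) 0; first by rewrite !mul0r.
rewrite (fV (phi n y)) ?mulr0// => -[/interior_subset Vny _].
apply: (Vb n y _ _ Vny).
  by split=> // bn0; apply: bny; rewrite bn0.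
by apply: contrapT => nVy; apply: fy; apply: fV => -[/interior_subset].
Qed.

Lemma dense_ideal_meets I :
  hausdorff_space X -> dense (aperiodic_points sigma tau) ->
  two_sided_ideal AxZ mul I -> I <> [set 0] -> I `&` A0 <> [set 0].
Proof.
move=> haus dap idI I0 IA0; apply: I0; have [IAxZ I00 _ _ IM] := idI.
apply/seteqP; split=> [a Ia|_ -> //]; apply: contrapT => /neq0_at[m am0].
have [Aa _] := IAxZ a Ia.
have [y amy] := neq0_at am0.
(* g is chosen to vanish off the image under phi m of the set where a m is
   non-zero, so that the degree 0 coefficient a m * (g \o phi m) of
   a * g delta^-m is non-zero. *)
have [g [Ag g0 gU]] : exists g, [/\ A g, g <> 0 &
    forall z, ~ a m (phi (- m) z) <> 0 -> g z = 0].
  apply: (@A_local (phi (- m) @^-1` [set z | a m z <> 0])).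
    apply: open_comp => [z _|]; first exact: phic.
    exact: open_neq0 (A_cont (Aa m)).
  by exists (phi m y); rewrite /= -(iterzD tauK sigmaK) addNr.
have Ib : I (mul a (monomial g (- m))).
  by apply: (IM _ _ _ Ia).2; exact: crossed_product_monomial.
have bE : mul a (monomial g (- m)) 0 = a m * (g \o phi m).
  by apply/funext => z; rewrite crossed_mul_monomial_r sub0r opprK.
have b0 : [set x | mul a (monomial g (- m)) 0 x <> 0] !=set0.
  have [z gz] := neq0_at g0; exists (phi (- m) z); rewrite /= bE.
  rewrite -[LHS]/(a m (phi (- m) z) * g (phi m (phi (- m) z))).
  rewrite -(iterzD tauK sigmaK) subrr => /eqP; rewrite mulf_eq0.
  by case/orP => /eqP // amz; apply: gz; apply: gU.
have [Ab _] := IAxZ _ Ib.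
have [x [/= bx xap]] := dap _ b0 (open_neq0 (A_cont (Ab 0))).
have [f [Af f0 If]] := ideal_detects haus idI Ib xap bx.
apply: f0; have : (I `&` A0) (monomial f 0) by split=> //; exists f.
by rewrite IA0 => /(congr1 (fun c => c 0)); rewrite /monomial eqxx.
Qed.

(** [shift m c] is c delta^m, a product taken outside the crossed product since
    A need not have a unit. *)
Definition shift (m : int) (c : int -> X -> R[i]^o) : int -> X -> R[i]^o :=
  fun k => c (k - m).

Lemma crossed_mul_shift_r (m : int) (a c : int -> X -> R[i]^o) :
  mul a (shift m c) = shift m (mul a c).
Proof.
apply/funext => n; rewrite /shift /crossed_mul.
by apply: eq_fsbigr => k _; rewrite addrAC.
Qed.

Definition fixed_supported (m : int) (c : int -> X -> R[i]^o) : Prop :=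
  forall k x, c k x <> 0 -> phi m x = x.

Lemma finite_support_shift m c :
  finite_set [set k | c k <> 0] -> finite_set [set k | shift m c k <> 0].
Proof.
move=> fc; apply: sub_finite_set (finite_image (fun k => k + m) fc) => k /= ck.
by exists (k - m) => //; rewrite subrK.
Qed.

Lemma crossed_product_shift m c : AxZ c -> AxZ (shift m c).
Proof.
by move=> [Ac fc]; split=> [k|]; [exact: Ac|exact: finite_support_shift].
Qed.

(** Left multiplication by delta^m twists b by [phi m], which is invisible on the
    support of c. *)
Lemma crossed_mul_shift_l m c b :
  finite_set [set k | c k <> 0] -> fixed_supported m c ->
  mul (shift m c) b = shift m (mul c b).
Proof.
move=> fc cm; apply/funext => n; apply/funext => x.
rewrite [RHS]crossed_mul_at// crossed_mul_at; last exact: finite_support_shift.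
rewrite (reindex_fsbigT (fun k => k + m)); last first.
  by exists (fun k => k - m) => k; rewrite ?addrK ?subrK.
apply: eq_fsbigr => k _; rewrite /shift addrK.
have [->|/eqP/cm mx] := eqVneq (c k x) 0; first by rewrite !mul0r.
by rewrite (iterzD tauK sigmaK) mx opprD addrA addrAC.
Qed.

Lemma fixed_supported_mul m a b :
  finite_set [set k | a k <> 0] -> finite_set [set k | b k <> 0] ->
  fixed_supported m b ->
  fixed_supported m (mul a b) /\ fixed_supported m (mul b a).
Proof.
move=> fa fb bm; split=> n x.
  move=> /(crossed_mul_neq0 fa)[k [_ /bm /(iterz_fixed_iterz tauK sigmaK (- k))]].
  by rewrite -(iterzD tauK sigmaK (- k)) addNr.
by move=> /(crossed_mul_neq0 fb)[k [/bm]].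
Qed.

(** Dividing by this ideal identifies f delta^m with f for every f in A vanishing
    off the fixed points of [phi m]. *)
Definition shift_ideal (m : int) : set (int -> X -> R[i]^o) :=
  [set c - shift m c | c in [set c | AxZ c /\ fixed_supported m c]].

Lemma shift_ideal_two_sided (m : int) : two_sided_ideal AxZ mul (shift_ideal m).
Proof.
split.
- move=> _ [c [Ac _] <-]; apply: crossed_productD => //.
  rewrite -scaleN1r; apply: crossed_productZ; exact: crossed_product_shift.
- exists 0; last by apply/funext => k; exact: subr0.
  by split; [exact: crossed_product0|].
- move=> _ _ [c [Ac cm] <-] [d [Ad dm] <-]; exists (c + d); last first.
    by rewrite opprD [RHS]addrACA; congr (_ + _); rewrite -opprD.
  split; first exact: crossed_productD.
  move=> k x; rewrite -[(c + d) k x]/(c k x + d k x).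
  have [->|/eqP/cm//] := eqVneq (c k x) 0; rewrite add0r; exact: dm.
- move=> z _ [c [Ac cm] <-]; exists (z *: c); last by rewrite scalerBr.
  split; first exact: crossed_productZ.
  move=> k x; rewrite -[(z *: c) k x]/(z * c k x).
  by have [->|/eqP/cm//] := eqVneq (c k x) 0; rewrite mulr0.
- move=> a _ Aa [c [Ac cm] <-].
  have [acm cam] := fixed_supported_mul Aa.2 Ac.2 cm.
  have fS := finite_support_shift m Ac.2.
  split; [exists (mul a c)|exists (mul c a)].
  + by split=> //; exact: crossed_productM.
  + apply/esym/eqP; rewrite -crossed_mul_shift_r eq_sym subr_eq.
    rewrite -crossed_mulDr ?subrK//; exact: Aa.2.
  + by split=> //; exact: crossed_productM.
  + apply/esym/eqP; rewrite -crossed_mul_shift_l//; last exact: Ac.2.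
    rewrite eq_sym subr_eq -crossed_mulDl ?subrK//.
    have [_] := crossed_productD Ac
      (crossed_productZ (-1) (crossed_product_shift m Ac)).
    by rewrite scaleN1r.
Qed.

(** If c - c delta^m is concentrated in degree 0, then c_k = c_(k-m) for every
    non-zero k.  So c is constant along 0, m, 2m, ... and along -m, -2m, ...;
    both constants vanish, and so does the degree 0 coefficient c_0 - c_(-m). *)
Lemma shift_ideal_meets m : m != 0 -> shift_ideal m `&` A0 = [set 0].
Proof.
move=> m0; apply/seteqP; split; last first.
  move=> _ ->; split.
    by case: (shift_ideal_two_sided m).
  by case: coefficient_copy_subalgebra => -[].
move=> _ [[c [[_ fc] _] <-] [f _ fE]].
have cE k : k != 0 -> c k = c (k - m).
  move=> k0; have /(congr1 (fun d => d k)) := fE.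
  rewrite /monomial (negPf k0) => /esym/eqP.
  rewrite -[X in X == _]/(c k - c (k - m)).
  by rewrite subr_eq0 => /eqP.
have c0 : c 0 = 0.
  apply: (@finite_support_progression _ c 0 m _) => //; elim=> [|j IH].
    by rewrite mulr0n addr0.
  rewrite cE; first by rewrite mulrSr addrA addrK.
  by rewrite add0r mulrn_eq0.
have cm : c (- m) = 0.
  apply: (@finite_support_progression _ c (- m) (- m) _) => //.
    by rewrite oppr_eq0.
  elim=> [|j IH]; first by rewrite mulr0n addr0.
  rewrite mulrSr addrA -cE //.
  by rewrite -mulrS mulrn_eq0 oppr_eq0.
rewrite -fE /=; apply/funext => k; rewrite /monomial.
case: eqP => // _; have /(congr1 (fun d => d 0)) := fE.
rewrite /monomial eqxx => ->; rewrite -[LHS]/(c 0 - c (0 - m)).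
by rewrite sub0r c0 cm subr0.
Qed.

Lemma ideal_meets_dense :
  baire_space X -> hausdorff_space X ->
  (forall I, two_sided_ideal AxZ mul I -> I <> [set 0] -> I `&` A0 <> [set 0]) ->
  dense (aperiodic_points sigma tau).
Proof.
move=> baire haus Imeets; apply: contrapT.
move=> /(open_periodic_points sigma_homeo baire haus)[n [U [oU U0 Uper]]].
have [f [Af f0 fU]] := A_local oU U0.
apply: (Imeets (shift_ideal n.+1)); last exact: shift_ideal_meets.
  exact: shift_ideal_two_sided.
move=> I0; have : shift_ideal n.+1 (monomial f 0 - shift n.+1 (monomial f 0)).
  exists (monomial f 0) => //; split; first exact: crossed_product_monomial.
  move=> k x; rewrite /monomial; case: eqP => // _ fx.
  by apply: Uper; apply: contrapT => /fU.
rewrite I0 => /(congr1 (fun c => c 0)).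
by rewrite -[LHS]/(f - 0) subr0.
Qed.

End Criteria.

Unset Implicit Arguments.
Set Strict Implicit.

Theorem theorem4p5 (R : realType) (X : topologicalType)
    (sigma tau : X -> X) (A : set (X -> R[i]^o))
    (X_baire : baire_space X)
    (X_hausdorff : hausdorff_space X)
    (sigma_homeo : homeomorphism_with_inverse sigma tau)
    (A_subalgebra : subalgebra (continuous_functions R X) *%R A)
    (A_invariant : forall f, A f -> A (precomp tau f) /\ A (precomp sigma f))
    (A_separates : separates_points A)
    (A_local : forall U : set X, open U -> U !=set0 ->
       exists f, [/\ A f, f <> 0 & forall x, ~ U x -> f x = 0]) :
  let AxZ := crossed_product A in
  let mul := crossed_mul (precomp tau) (precomp sigma) in
  let A0 := coefficient_copy A in
  (maximal_abelian_subalgebra AxZ mul A0 <->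
     dense (aperiodic_points sigma tau))
  /\
  (dense (aperiodic_points sigma tau) <->
     forall I, two_sided_ideal AxZ mul I ->
       I <> [set 0] -> I `&` A0 <> [set 0]).
Proof.
move=> AxZ mul A0; split; split.
- exact: maximal_abelian_dense.
- exact: dense_maximal_abelian.
- by move=> dap I; exact: dense_ideal_meets.
- exact: ideal_meets_dense.
Qed.
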